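(* Let $c,L>0$ and $0<\xi<c$. For all sufficiently large $N\in\mathbb{N}$ (equivalently, for $h=\frac{L}{N+1}$ small enough), the $2N+2$ eigenvalues of the matrix $\mathcal{A}_h^{FD}(\xi)$ (defined in the context) can be enumerated as $\lambda_j^{FD}(\xi,h)$, $j=1,2,\ldots,2N+2$, so that for all $j=1,\ldots,2N+2$ $$h\,\bigl|\mathrm{Re}\,\lambda_j^{FD}(\xi,h)\bigr| = O(h),\qquad h\,\bigl|\mathrm{Im}\,\lambda_j^{FD}(\xi,h)\bigr| = 2c\left|\sin\left(\frac{2j\pi}{4N+5}\right)\right|+O(h),$$ and hence $$h^2\bigl|\lambda_j^{FD}(\xi,h)\bigr|^2\le 4c^2\sin^2\left(\frac{2j\pi}{4N+5}\right)+O(h).$$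
   Context: Let $c>0$, $L>0$ be constants, $\xi$ the feedback gain, $N\in\mathbb{N}$ and $h=\frac{L}{N+1}$. The finite difference semi-discretization of the boundary-damped wave equation $\ddot v=c^2v_{xx}$ on $(0,L)$, $v(0,t)=0$, $c^2v_x(L,t)=-\xi\dot v(L,t)$, is $$\ddot v_j-c^2\frac{v_{j+1}+v_{j-1}-2v_j}{h^2}=0\ (1\le j\le N),\qquad v_0=0,\qquad \ddot v_{N+1}+c^2\frac{v_{N+1}-v_N}{h^2}+\frac{\xi}{h}\dot v_{N+1}=0.$$ With $\vec u_1=(v_1,\dots,v_{N+1})^{\rm T}$, $\vec u_2=(\dot v_1,\dots,\dot v_{N+1})^{\rm T}$ it reads $\frac{d}{dt}(\vec u_1,\vec u_2)=\mathcal{A}_h^{FD}(\xi)(\vec u_1,\vec u_2)$, where $\mathcal{A}_h^{FD}(\xi)(\vec u_1,\vec u_2)=(\vec u_2,\,-A_h\vec u_1+B_h\vec u_2)$ is a $(2N+2)\times(2N+2)$ real matrix. Here $A_h$ is the $(N+1)\times(N+1)$ matrix equal to $\frac{c^2}{h^2}$ times the tridiagonal matrix with off-diagonal entries $-1$, diagonal entries $2$ in rows $1,\dots,N$ and diagonal entry $1$ in row $N+1$; and $B_h$ is the $(N+1)\times(N+1)$ matrix whose only nonzero entry is $(B_h)_{N+1,N+1}=-\xi/h$. The notation $O(h)$ refers to $N\to\infty$ (i.e. $h\to0$) with $c,L,\xi$ fixed, with implied constants independent of $j$ and $N$. *)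

(* Defs.v *)
From mathcomp Require Import all_boot all_order all_algebra.
From mathcomp Require Import complex.
From mathcomp Require Import reals trigo.

Set Implicit Arguments.
Unset Strict Implicit.
Unset Printing Implicit Defensive.

Import Order.TTheory GRing.Theory Num.Theory.

Local Open Scope ring_scope.
Local Open Scope complex_scope.

Definition mesh (R : realType) (L : R) (N : nat) : R := L / N.+1%:R.

(* Rows and columns are numbered from 0, so row N of the matrix is the boundary
   node N + 1 of the grid. *)
Definition FD_stiffness (R : realType) (c L : R) (N : nat) : 'M[R]_N.+1 :=
  (c ^+ 2 / mesh L N ^+ 2) *:
    \matrix_(i < N.+1, j < N.+1)
      (if i == j then (if i == ord_max then 1 else 2)
       else if (i.+1 == j :> nat) || (j.+1 == i :> nat) then -1 else 0).

Definition FD_damping (R : realType) (L xi : R) (N : nat) : 'M[R]_N.+1 :=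
  \matrix_(i < N.+1, j < N.+1)
    (if (i == ord_max) && (j == ord_max) then - xi / mesh L N else 0).

(* The matrix acts on column vectors: (u1, u2) is [col_mx u1 u2]. *)
Definition FD_matrix (R : realType) (c L xi : R) (N : nat) :
    'M[R]_(N.+1 + N.+1) :=
  block_mx 0 1%:M (- FD_stiffness c L N) (FD_damping L xi N).

(* [lambda 1, ..., lambda n] are the complex eigenvalues of the real matrix [A],
   counted with algebraic multiplicity; the values of [lambda] at other indices
   are irrelevant. *)
Definition eigenvalue_enumeration (R : realType) (n : nat) (A : 'M[R]_n)
    (lambda : nat -> R[i]) : Prop :=
  char_poly (map_mx (real_complex R) A) =
    \prod_(1 <= j < n.+1) ('X - (lambda j)%:P).

(* Main.v *)
(** With a = xi / c, n = 4 N + 6 and lambda = (c / h) (w - 1 / w), the sequence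
    w^(2k) - w^(-2k) solves the interior equations of the eigenvalue problem, and
    the boundary equation becomes w^n + a w^(n-1) - a w + 1 = 0.  Since a < 1, its
    roots have modulus 1 + O(1/N), and they are simple for N large.  The
    only imaginary ones are i and -i, and w -> - 1 / w exchanges the others between
    the two half-planes, so at least 2 N + 2 of them have positive real part.
    Taking arguments in w^n (1 + a / w) = - (1 - a w), whose factors 1 + a / w and
    1 - a w lie in the right half-plane, attaches to each root an integer k with
    arg w = (2 k + 1) pi / n + O(1/N).  For N large k determines the root, because
    both factors are Lipschitz while the power contributes a factor n.  A priori
    - N - 2 <= k <= N + 1 on the right half-plane; the two extreme values belong to
    w = -i and w = i, so by counting each k in - N - 1, ..., N is attained exactly
    once, which locates all 2 N + 2 eigenvalues. *)

Require Import Defs.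
From mathcomp Require Import all_boot all_order all_algebra.
From mathcomp Require Import complex.
From mathcomp Require Import reals trigo.
From mathcomp Require Import boolp classical_sets topology normedtype derive realfun.
From mathcomp Require Import ring lra zify.

Set Implicit Arguments.
Unset Strict Implicit.
Unset Printing Implicit Defensive.

Import Order.TTheory GRing.Theory Num.Theory.
Import numFieldNormedType.Exports.

Local Open Scope ring_scope.
Local Open Scope complex_scope.

(** * Lipschitz bounds and periodicity for the trigonometric functions *)

Section Trigonometry.
Variable R : realType.
Implicit Types x y : R.

Lemma lipschitz1_of_derive (f df : R -> R) x y :
  (forall z, is_derive z (1 : R) f (df z)) -> (forall z, `|df z| <= 1) ->
  `|f x - f y| <= `|x - y|.
Proof.
move=> fdf df_le1; wlog le_yx : x y / y <= x.
  by move=> H; case: (leP y x) => [/H//|/ltW/H]; rewrite distrC (distrC y).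
have cf : {within `[y, x], continuous f}%classic.
  apply: continuous_subspaceT => z; apply/differentiable_continuous.
  by apply/derivable1_diffP; case: (fdf z).
have [z _ ->] := MVT_segment le_yx (fun z _ => fdf z) cf.
by rewrite normrM ler_piMl.
Qed.

Lemma sin_lipschitz x y : `|sin x - sin y| <= `|x - y|.
Proof. exact: (@lipschitz1_of_derive _ cos) (@cos_max R). Qed.

Lemma cos_lipschitz x y : `|cos x - cos y| <= `|x - y|.
Proof.
apply: (@lipschitz1_of_derive _ (fun z => - sin z)) => z.
by rewrite normrN sin_max.
Qed.

Lemma atan_lipschitz x y : `|atan x - atan y| <= `|x - y|.
Proof.
apply: (@lipschitz1_of_derive _ (fun z => (1 + z ^+ 2)^-1)) => z.
have h : 1 <= 1 + z ^+ 2 by rewrite lerDl sqr_ge0.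
by rewrite ger0_norm ?invr_ge0 ?invf_le1 ?(le_trans _ h) ?(lt_le_trans _ h).
Qed.

Lemma cosD_2pi_int x (k : int) : cos (x + 2 * pi * k%:~R) = cos x.
Proof.
have H (m : nat) y : cos (y + 2 * pi * m%:R) = cos y.
  have -> : 2 * pi * m%:R = (pi *+ 2) *+ m :> R.
    by rewrite -[RHS]mulr_natr -(mulr_natl pi).
  by rewrite -[in LHS]mulr_natr; elim: m => [|m IH];
     rewrite ?mulr0 ?addr0// -natr1 mulrDr mulr1 addrA cosD2pi.
by case: k => m; rewrite ?NegzE ?intrN ?mulrN /= -?(H m x) -?pmulrn// -(H m.+1) subrK.
Qed.

(** Subtracting a multiple of [2 * pi] leaves [y] in [[0, 2 pi)]. If [y <= pi], injectivity of [cos]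
    on [[0, pi]] gives [y = 0]; otherwise the same argument for [2 * pi - y] contradicts
    [y < 2 * pi]. *)
Lemma cos_eq1 x : cos x = 1 -> exists k : int, x = 2 * pi * k%:~R.
Proof.
have pi0 := @pi_gt0 R; have pi20 : 0 < 2 * pi :> R by rewrite mulr_gt0.
move=> cx; pose k := Num.floor (x / (2 * pi)); exists k.
pose y := x - 2 * pi * k%:~R.
have cy : cos y = 1 by rewrite -cx -(cosD_2pi_int y k) subrK.
have /andP[] : (k%:~R : R) <= x / (2 * pi) < (k + 1)%:~R.
  by rewrite floor_le floorD1_gt.
rewrite ler_pdivlMr// ltr_pdivrMr// intrD => h1 h2.
have y0 : 0 <= y by rewrite /y; lra.
have y2 : y < 2 * pi by rewrite /y; lra.
suff : y = 0 by rewrite /y; lra.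
have [ypi|ypi] := leP y pi.
  by apply: cos_inj; rewrite ?in_itv/= ?y0 ?ypi ?lexx ?(ltW pi0)// cos0.
suff : 2 * pi - y = 0 by lra.
apply: cos_inj; rewrite ?in_itv/= ?lexx ?(ltW pi0)//.
  by apply/andP; split; lra.
rewrite cos0 -cosN opprB -[RHS]cy -[RHS](cosD_2pi_int y (-1)).
by rewrite intrN mulrN mulr1.
Qed.

End Trigonometry.

(** * Elementary inequalities for powers and quotients *)

Section RealEstimates.
Variable R : realFieldType.
Implicit Types x y r : R.

Lemma bernoulli (n : nat) r : 1 <= r -> 1 + n%:R * (r - 1) <= r ^+ n.
Proof.
move=> r1; elim: n => [|n IH]; first by rewrite mul0r addr0.
rewrite exprS (le_trans _ (ler_wpM2l (le_trans ler01 r1) IH))//.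
rewrite -subr_ge0 -natr1.
have -> : r * (1 + n%:R * (r - 1)) - (1 + (n%:R + 1) * (r - 1)) = n%:R * (r - 1) ^+ 2.
  by ring.
by rewrite mulr_ge0 ?sqr_ge0.
Qed.

(** For [y <= x], Bernoulli's inequality gives [(x / y) ^+ m - 1 >= m (x - y) / y]; multiplying by
    [y ^+ m >= q] and using [y <= 2] yields the bound. This is how the power gains a factor [m] over
    Lipschitz terms. *)
Lemma expr_dist_ge (m : nat) (q x y : R) : 0 < x <= 2 -> 0 < y <= 2 ->
  q <= x ^+ m -> q <= y ^+ m -> m%:R * `|x - y| * (q / 2) <= `|x ^+ m - y ^+ m|.
Proof.
wlog le_yx : x y / y <= x.
  by move=> H; case: (leP y x) => [/H//|/ltW/H{}H *]; rewrite distrC (distrC (x ^+ m)) H.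
move=> /andP[x0 x2] /andP[y0 y2] _ qy.
have xy1 : 1 <= x / y by rewrite ler_pdivlMr// mul1r.
rewrite !ger0_norm ?subr_ge0 ?lerXn2r ?nnegrE ?(ltW x0) ?(ltW y0)//.
have xE : x = x / y * y by rewrite divfK// gt_eqF.
rewrite [in x ^+ m]xE exprMn.
have := bernoulli m xy1; set p := (x / y) ^+ m => pge.
have ym : 0 < y ^+ m by rewrite exprn_gt0.
have -> : p * y ^+ m - y ^+ m = (p - 1) * y ^+ m by ring.
apply: (@le_trans _ _ (m%:R * (x / y - 1) * y ^+ m)); last first.
  by rewrite ler_pM2r// lerBrDl.
have -> : x / y - 1 = (x - y) * y^-1 by rewrite mulrBl divff// gt_eqF.
have -> : m%:R * ((x - y) / y) * y ^+ m = m%:R * (x - y) * (y ^+ m / y) by ring.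
rewrite ler_wpM2l ?mulr_ge0 ?subr_ge0// (le_trans (y := y ^+ m / 2))//.
  by rewrite ler_pM2r // invr_gt0.
by rewrite ler_wpM2l ?(ltW ym)// lef_pV2 ?posrE.
Qed.

Lemma div_lipschitz (d M x1 x2 y1 y2 : R) : 0 < d -> d <= y1 -> d <= y2 ->
  `|x1| <= M -> `|y1| <= M ->
  `|x1 / y1 - x2 / y2| <= M * (`|x1 - x2| + `|y1 - y2|) / d ^+ 2.
Proof.
move=> d0 dy1 dy2 x1M y1M.
have y10 := lt_le_trans d0 dy1; have y20 := lt_le_trans d0 dy2.
have M0 : 0 <= M := le_trans (normr_ge0 _) x1M.
have -> : x1 / y1 - x2 / y2 = (x1 * (y2 - y1) + y1 * (x1 - x2)) / (y1 * y2).
  by field; rewrite !gt_eqF.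
rewrite normrM normfV (ger0_norm (mulr_ge0 (ltW y10) (ltW y20))).
rewrite ler_pM ?invr_ge0 ?mulr_ge0 ?(ltW y10) ?(ltW y20)//; last first.
  by rewrite lef_pV2 ?posrE ?mulr_gt0 ?exprn_gt0// expr2 ler_pM// ltW.
by rewrite (le_trans (ler_normD _ _))// !normrM addrC mulrDr (distrC y2) lerD// ler_wpM2r.
Qed.

End RealEstimates.

(** * Modulus and argument of the factor [1 - a w] *)

Section Factor.
Variables (R : realType) (a : R).
Hypothesis a01 : 0 < a < 1.
Implicit Types r s phi : R.

(** Squared modulus of [1 - a w] at [w = r e^(i phi)], with [factor_arg] its argument. Since
    [- 1 / w] has modulus [r^-1] and argument [pi - phi], the same two functions at those values
    describe [1 + a / w]. *)
Definition factor_sqnorm r phi := 1 - 2 * (a * r) * cos phi + (a * r) ^+ 2.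

Definition factor_arg r phi :=
  atan (- (a * r * sin phi) / (1 - a * r * cos phi)).

(** The midpoint of [a] and [1]: while [a * r <= b], the real part of [1 - a w] stays above
    [d > 0]. *)
Let b := (1 + a) / 2.
Let d := 1 - b.

Lemma factor_re_bounds r phi : 0 < r -> a * r <= b ->
  d <= 1 - a * r * cos phi /\ `|1 - a * r * cos phi| <= 2.
Proof.
have /andP[a_gt0 a_lt1] := a01.
move=> r0 arb; have t0 : 0 < a * r by rewrite mulr_gt0.
have : `|a * r * cos phi| <= b.
  by rewrite normrM gtr0_norm// (le_trans _ arb)// ler_piMr ?cos_max// ltW.
rewrite !ler_norml => /andP[h1 h2].
have b1 : b <= 1 by rewrite /b; lra.
split; first by rewrite /d; lra.
by apply/andP; split; lra.
Qed.

Lemma factor_sqnorm_bounds r phi : 0 < r -> a * r <= b ->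
  d ^+ 2 <= factor_sqnorm r phi <= 4.
Proof.
have /andP[a_gt0 a_lt1] := a01.
move=> r0 arb; have t0 : 0 < a * r by rewrite mulr_gt0.
have t1 : a * r <= 1 by rewrite (le_trans arb)// /b; lra.
have hd : 0 < d <= 1 - a * r by rewrite /d lerB// andbT /b; lra.
rewrite /factor_sqnorm; set t := a * r in t0 t1 hd *.
have /andP[hd0 hd1] := hd.
have := cos_le1 phi; have := cos_geN1 phi; set c := cos phi => c1 c2.
by apply/andP; split; nra.
Qed.

Lemma mul_lipschitz_cos r1 r2 phi1 phi2 : 0 < r2 -> a * r2 <= 1 ->
  `|a * r1 * cos phi1 - a * r2 * cos phi2| <= `|r1 - r2| + `|phi1 - phi2|.
Proof.
have /andP[a_gt0 a_lt1] := a01.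
move=> r0 ar1; have t0 : 0 < a * r2 by rewrite mulr_gt0.
have -> : a * r1 * cos phi1 - a * r2 * cos phi2 =
  a * (r1 - r2) * cos phi1 + a * r2 * (cos phi1 - cos phi2) by ring.
rewrite (le_trans (ler_normD _ _))// !normrM lerD//.
  rewrite -[leRHS]mulr1 ler_pM ?mulr_ge0 ?cos_max//.
  by rewrite ler_piMl// gtr0_norm// ltW.
by rewrite -normrM gtr0_norm// (le_trans (ler_piMl _ ar1))// cos_lipschitz.
Qed.

Lemma mul_lipschitz_sin r1 r2 phi1 phi2 : 0 < r2 -> a * r2 <= 1 ->
  `|a * r1 * sin phi1 - a * r2 * sin phi2| <= `|r1 - r2| + `|phi1 - phi2|.
Proof.
have /andP[a_gt0 a_lt1] := a01.
move=> r0 ar1; rewrite -!cosBpihalf (le_trans (mul_lipschitz_cos _ _ _ r0 ar1))//.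
by rewrite lerD// le_eqVlt; apply/orP; left; apply/eqP; congr (`|_|); ring.
Qed.

Lemma factor_sqnorm_lipschitz r1 r2 phi1 phi2 :
    0 < r1 -> 0 < r2 -> a * r1 <= 1 -> a * r2 <= 1 ->
  `|factor_sqnorm r1 phi1 - factor_sqnorm r2 phi2| <=
    4 * (`|r1 - r2| + `|phi1 - phi2|).
Proof.
have /andP[a_gt0 a_lt1] := a01.
move=> r10 r20 ar1 ar2.
have -> : factor_sqnorm r1 phi1 - factor_sqnorm r2 phi2 =
  - 2 * (a * r1 * cos phi1 - a * r2 * cos phi2) + (a * r1 + a * r2) * (a * (r1 - r2)).
  by rewrite /factor_sqnorm; ring.
rewrite (le_trans (ler_normD _ _))// !normrM.
have h1 := mul_lipschitz_cos r1 phi1 phi2 r20 ar2.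
have h2 : `|a * r1 + a * r2| <= 2.
  by rewrite ger0_norm ?addr_ge0 ?mulr_ge0 ?(ltW a_gt0) ?(ltW r10) ?(ltW r20)//; lra.
have h3 : `|a| * `|r1 - r2| <= `|r1 - r2| by rewrite ler_piMl// gtr0_norm// ltW.
have -> : `|-2 : R| = 2 by rewrite normrN ger0_norm.
have h4 : `|a * r1 + a * r2| * (`|a| * `|r1 - r2|) <= 2 * `|r1 - r2|.
  by rewrite ler_pM ?mulr_ge0.
have := normr_ge0 (phi1 - phi2); lra.
Qed.

(** [atan] is 1-Lipschitz, and its argument is a quotient with entries at most 2 and denominator at
    least [d]; numerator and denominator each vary by at most the sum of the increments, whence
    [2 * 2 / d ^+ 2]. *)
Lemma factor_arg_lipschitz r1 r2 phi1 phi2 :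
    0 < r1 -> 0 < r2 -> a * r1 <= b -> a * r2 <= b ->
  `|factor_arg r1 phi1 - factor_arg r2 phi2| <=
    4 / d ^+ 2 * (`|r1 - r2| + `|phi1 - phi2|).
Proof.
have /andP[a_gt0 a_lt1] := a01.
move=> r10 r20 ar1 ar2.
have b1 : b <= 1 by rewrite /b; lra.
have ar11 := le_trans ar1 b1; have ar21 := le_trans ar2 b1.
have d0 : 0 < d by rewrite /d /b; lra.
rewrite (le_trans (atan_lipschitz _ _))//.
have [h1 h2] := factor_re_bounds phi1 r10 ar1.
have [h3 _] := factor_re_bounds phi2 r20 ar2.
have h4 : `|- (a * r1 * sin phi1)| <= 2.
  rewrite normrN normrM gtr0_norm ?mulr_gt0//.
  by rewrite -[leRHS]mulr1 ler_pM ?sin_max ?mulr_ge0 ?(ltW a_gt0) ?(ltW r10)//; lra.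
rewrite (le_trans (div_lipschitz _ d0 h1 h3 h4 h2))//.
rewrite [leRHS]mulrAC ler_pM2r ?invr_gt0 ?exprn_gt0//.
have -> : - (a * r1 * sin phi1) - - (a * r2 * sin phi2) =
  - (a * r1 * sin phi1 - a * r2 * sin phi2) by ring.
have -> : 1 - a * r1 * cos phi1 - (1 - a * r2 * cos phi2) =
  - (a * r1 * cos phi1 - a * r2 * cos phi2) by ring.
rewrite !normrN.
have := mul_lipschitz_cos r1 phi1 phi2 r20 ar21.
have := mul_lipschitz_sin r1 phi1 phi2 r20 ar21.
lra.
Qed.

End Factor.

(** * Polar coordinates in the complex plane *)

Section Polar.
Variable R : realType.
Implicit Types (r phi : R) (z w : R[i]).

Definition cis phi : R[i] := cos phi +i* sin phi.

Lemma cisD phi psi : cis (phi + psi) = cis phi * cis psi.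
Proof. by rewrite /cis; simpc; rewrite cosD sinD (addrC (sin phi * _)). Qed.

Lemma cis_expn phi n : cis phi ^+ n = cis (n%:R * phi).
Proof.
elim: n => [|n IH]; first by rewrite mul0r /cis cos0 sin0.
by rewrite exprS IH -cisD -natr1 mulrDl mul1r addrC.
Qed.

Lemma cisDpi phi : cis (phi + pi) = - cis phi.
Proof. by rewrite /cis cosDpi sinDpi; simpc. Qed.

Lemma cisN phi : cis phi * cis (- phi) = 1.
Proof. by rewrite -cisD subrr /cis cos0 sin0. Qed.

Lemma polar_eq (r s phi psi : R) : 0 < r -> 0 < s ->
  r%:C * cis phi = s%:C * cis psi ->
  r = s /\ exists k : int, phi - psi = 2 * pi * k%:~R.
Proof.
move=> r0 s0; rewrite /cis; simpc => -[hc hs].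
have rs : r = s.
  apply/eqP; rewrite -(@eqrXn2 _ 2) ?ltW//; apply/eqP.
  have := cos2Dsin2 phi; have := cos2Dsin2 psi => h1 h2.
  have -> : r ^+ 2 = (r * cos phi) ^+ 2 + (r * sin phi) ^+ 2.
    by rewrite !exprMn -mulrDr h2 mulr1.
  by rewrite hc hs !exprMn -mulrDr h1 mulr1.
split=> //; subst s; apply: cos_eq1; rewrite cosB.
have r_neq0 : r != 0 by rewrite gt_eqF.
by rewrite (mulfI r_neq0 hc) (mulfI r_neq0 hs) -!expr2 cos2Dsin2.
Qed.

Lemma polar_right_half_plane (x y : R) : 0 < x ->
  x +i* y = (Num.sqrt (x ^+ 2 + y ^+ 2))%:C * cis (atan (y / x)).
Proof.
move=> x0; rewrite /cis; simpc.
have h : Num.sqrt (x ^+ 2 + y ^+ 2) * cos (atan (y / x)) = x.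
  rewrite cos_atan; have -> : x ^+ 2 + y ^+ 2 = x ^+ 2 * (1 + (y / x) ^+ 2).
    by field; rewrite gt_eqF.
  rewrite sqrtrM ?sqr_ge0// sqrtr_sqr gtr0_norm// mulfK//.
  by rewrite gt_eqF// sqrtr_gt0 ltr_pwDl// sqr_ge0.
rewrite h; congr (_ +i* _).
have c0 : cos (atan (y / x)) != 0.
  by rewrite gt_eqF// cos_gt0_pihalf// atan_gtNpi2 atan_ltpi2.
have := atanK (y / x); rewrite /tan => /(canRL (divfK c0)) ->.
by rewrite mulrCA h divfK// gt_eqF.
Qed.

End Polar.

(** * The root equation in polar form, and uniqueness of the root on a branch *)

Section Phase.
Variables (R : realType) (a : R).
Hypothesis a01 : 0 < a < 1.
Implicit Types (r phi : R) (k : int).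

Let b := (1 + a) / 2.
Let d := 1 - b.

Lemma factor_polar r phi : 0 < r -> a * r <= b ->
  1 - a%:C * (r%:C * cis phi) =
    (Num.sqrt (factor_sqnorm a r phi))%:C * cis (factor_arg a r phi).
Proof.
move=> r0 arb; have /andP[a0 a1] := a01.
have d0 : 0 < d by rewrite /d /b; lra.
have [h _] := factor_re_bounds a01 phi r0 arb.
have := @polar_right_half_plane R _ (- (a * r * sin phi)) (lt_le_trans d0 h).
have -> : factor_sqnorm a r phi = (1 - a * r * cos phi) ^+ 2 + (- (a * r * sin phi)) ^+ 2.
  rewrite /factor_sqnorm; have := cos2Dsin2 phi; set c := cos phi; set s := sin phi => cs.
  have -> : (1 - a * r * c) ^+ 2 + (- (a * r * s)) ^+ 2 =
    1 - 2 * (a * r) * c + (a * r) ^+ 2 * (c ^+ 2 + s ^+ 2) by ring.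
  by rewrite cs mulr1.
by move=> <-; rewrite /cis; simpc; rewrite !mulrA.
Qed.

(* The polar form of [w ^+ n * (1 + a / w) = - (1 - a * w)] at [w = r e^(i phi)];
   [k] records the branch of the argument. *)
Definition polar_root n k r phi :=
  r ^+ (2 * n) * factor_sqnorm a r^-1 (pi - phi) = factor_sqnorm a r phi /\
  n%:R * phi + factor_arg a r^-1 (pi - phi) - factor_arg a r phi
    = pi + 2 * pi * k%:~R.

(** A range of moduli invariant under [r -> r^-1]. The bounds by [b] keep both factors in the right
    half-plane; the bounds by 2 serve the power estimate and make inversion Lipschitz. *)
Definition admissible r := [/\ 0 < r, a * r <= b, a * r^-1 <= b, r <= 2 & r^-1 <= 2].

Lemma exists_polar_root n r phi (w := r%:C * cis phi) : admissible r ->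
  w ^+ n * (1 + a%:C / w) = - (1 - a%:C * w) -> exists k, polar_root n k r phi.
Proof.
move=> [r0 arb asb _ _] eqw; have s0 : 0 < r^-1 by rewrite invr_gt0.
have /andP[a0 a1] := a01; have d0 : 0 < d by rewrite /d /b; lra.
have /andP[h1 _] := factor_sqnorm_bounds a01 phi r0 arb.
have /andP[h2 _] := factor_sqnorm_bounds a01 (pi - phi) s0 asb.
have {}h1 := lt_le_trans (exprn_gt0 2 d0) h1.
have {}h2 := lt_le_trans (exprn_gt0 2 d0) h2.
have wV : w^-1 = - (r^-1%:C * cis (pi - phi)).
  have wm : w * - (r^-1%:C * cis (pi - phi)) = 1.
    rewrite /w addrC cisDpi !mulrN opprK mulrACA cisN mulr1 -rmorphM/= divff ?rmorph1//.
    by rewrite gt_eqF.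
  have w_neq0 : w != 0.
    by apply/eqP => w0; move/eqP: wm; rewrite w0 mul0r eq_sym oner_eq0.
  by apply: (mulfI w_neq0); rewrite wm divff.
move: eqw; rewrite wV mulrN -[1 - _ in LHS]/(1 - a%:C * _) !factor_polar// /w.
(* The minus sign of the right-hand side becomes a rotation by [pi], the source of the term [pi] in
   [polar_root]. *)
rewrite exprMn cis_expn -rmorphXn mulrACA -rmorphM -cisD -mulrN -cisDpi.
move/polar_eq; rewrite !mulr_gt0 ?exprn_gt0 ?sqrtr_gt0// => -[]// hr [k hk].
exists k; split; last by lra.
rewrite mulnC exprM -[factor_sqnorm a r phi]sqr_sqrtr ?ltW// -hr exprMn.
by rewrite sqr_sqrtr ?ltW.
Qed.

(* The factors in the polar equations are Lipschitz with constants at most 20 / d^2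
   (argument) and 320 / d^6 (modulus); [n] beats their sum. *)
Lemma polar_root_inj n k r1 r2 phi1 phi2 : 340 / d ^+ 6 < n%:R ->
    admissible r1 -> admissible r2 ->
    polar_root n k r1 phi1 -> polar_root n k r2 phi2 ->
  r1 = r2 /\ phi1 = phi2.
Proof.
move=> n_large [r10 ar1 as1 r12 s12] [r20 ar2 as2 r22 s22] [m1 p1] [m2 p2].
have /andP[a0 a1] := a01.
have b1 : b <= 1 by rewrite /b; lra.
have d0 : 0 < d by rewrite /d /b; lra.
have d1 : d <= 1 by rewrite /d /b; lra.
have s10 : 0 < r1^-1 by rewrite invr_gt0.
have s20 : 0 < r2^-1 by rewrite invr_gt0.
pose er : R := `|r1 - r2|; pose ep : R := `|phi1 - phi2|; pose es : R := `|r1^-1 - r2^-1|.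
have er0 : 0 <= er := normr_ge0 _; have ep0 : 0 <= ep := normr_ge0 _.
have es_le : es <= 4 * er.
  have -> : es = er * (r1^-1 * r2^-1).
    have -> : er * (r1^-1 * r2^-1) = `|(r1 - r2) * (r1^-1 * r2^-1)|.
      by rewrite normrM (gtr0_norm (mulr_gt0 s10 s20)).
    rewrite /es distrC; congr (`|_|); field.
    by rewrite !gt_eqF.
  rewrite mulrC ler_wpM2r// (_ : 4 = 2 * 2); last by ring.
  by rewrite ler_pM// ltW.
have epi : `|(pi - phi1) - (pi - phi2)| = ep.
  by rewrite /ep distrC; congr (`|_|); ring.
have A1 := factor_arg_lipschitz a01 phi1 phi2 r10 r20 ar1 ar2.
have A2 := factor_arg_lipschitz a01 (pi - phi1) (pi - phi2) s10 s20 as1 as2.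
have D1 := factor_sqnorm_lipschitz a01 phi1 phi2 r10 r20 (le_trans ar1 b1) (le_trans ar2 b1).
have D2 := factor_sqnorm_lipschitz a01 (pi - phi1) (pi - phi2) s10 s20
  (le_trans as1 b1) (le_trans as2 b1).
rewrite -/b -/d -/er -/ep in A1 A2 D1 D2; rewrite -/es epi in A2 D2.
have d20 : 0 < d ^+ 2 by rewrite exprn_gt0.
(* The two bounds add up to [4 / d ^+ 2 * (er + ep + es + ep)], and [es <= 4 * er] turns this into
   the constant 20. *)
have phase : n%:R * ep <= 20 / d ^+ 2 * (er + ep).
  have -> : n%:R * ep = `|n%:R * (phi1 - phi2)| by rewrite normrM normr_nat.
  have -> : n%:R * (phi1 - phi2) =
      (factor_arg a r1 phi1 - factor_arg a r2 phi2) -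
      (factor_arg a r1^-1 (pi - phi1) - factor_arg a r2^-1 (pi - phi2)) by lra.
  rewrite (le_trans (ler_normB _ _))// (le_trans (lerD A1 A2))// -mulrDr.
  rewrite mulrAC [leRHS]mulrAC ler_pM2r ?invr_gt0//; lra.
have [g11 g12] := andP (factor_sqnorm_bounds a01 phi1 r10 ar1).
have [g21 g22] := andP (factor_sqnorm_bounds a01 phi2 r20 ar2).
have [h11 h12] := andP (factor_sqnorm_bounds a01 (pi - phi1) s10 as1).
have [h21 h22] := andP (factor_sqnorm_bounds a01 (pi - phi2) s20 as2).
rewrite -/b -/d in g11 g21 h11 h21.
have norm4 (z : R) : d ^+ 2 <= z -> z <= 4 -> `|z| <= 4.
  by move=> dz z4; rewrite ger0_norm// (le_trans (ltW d20)).
have E1 : r1 ^+ (2 * n) = factor_sqnorm a r1 phi1 / factor_sqnorm a r1^-1 (pi - phi1).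
  by rewrite -m1 mulfK// gt_eqF// (lt_le_trans d20).
have E2 : r2 ^+ (2 * n) = factor_sqnorm a r2 phi2 / factor_sqnorm a r2^-1 (pi - phi2).
  by rewrite -m2 mulfK// gt_eqF// (lt_le_trans d20).
have q (x y : R) : d ^+ 2 <= x -> d ^+ 2 <= y -> y <= 4 -> d ^+ 2 / 4 <= x / y.
  by move=> dx dy y4; rewrite ler_pM ?invr_ge0 ?(ltW d20)// lef_pV2 ?posrE// (lt_le_trans d20).
(* Each [2 n]-th power is a quotient of squared norms in [[d ^+ 2, 4]], hence at least [d ^+ 2 / 4].
   The quotient is Lipschitz with constant [80 / d ^+ 4]; dividing by the gain [2 n * d ^+ 2 / 8]
   gives 320. *)
have modulus : n%:R * er <= 320 / d ^+ 6 * (er + ep).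
  have := @expr_dist_ge _ (2 * n) (d ^+ 2 / 4) r1 r2.
  rewrite r10 r12 r20 r22 E1 E2 !q// => /(_ isT isT isT isT) H.
  have := div_lipschitz (factor_sqnorm a r2 phi2) d20 h11 h21 (norm4 _ g11 g12) (norm4 _ h11 h12).
  move/(le_trans H); rewrite -/er => {}H.
  have {H} : (2 * n)%:R * er * (d ^+ 2 / 4 / 2) <= 80 * (er + ep) / d ^+ 2 ^+ 2.
    rewrite (le_trans H)// ler_pM2r ?invr_gt0 ?exprn_gt0//; lra.
  rewrite -exprM ler_pdivlMr ?exprn_gt0// natrM => H.
  rewrite mulrAC ler_pdivlMr ?exprn_gt0//.
  have -> : n%:R * er * d ^+ 6 = 4 * (2 * n%:R * er * (d ^+ 2 / 4 / 2) * d ^+ 4) by field.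
  by lra.
have d6 : d ^+ 6 <= d ^+ 2 by rewrite ler_wiXn2l// ltW.
(* Adding the two estimates, with [d <= 1], bounds [n * (er + ep)] by [340 / d ^+ 6 * (er + ep)]; a
   positive sum would contradict the size of [n]. *)
have E0 : er + ep = 0.
  apply/eqP; rewrite eq_le addr_ge0// andbT leNgt; apply/negP => Epos.
  have : n%:R * (er + ep) <= 340 / d ^+ 6 * (er + ep).
    have : 20 / d ^+ 2 * (er + ep) <= 20 / d ^+ 6 * (er + ep).
      by rewrite ler_pM2r// ler_pM2l// lef_pV2 ?posrE ?exprn_gt0.
    by move: phase modulus; lra.
  by rewrite ler_pM2r// leNgt n_large.
have er_0 : er = 0 by lra. have ep_0 : ep = 0 by lra.
by split; apply/eqP; rewrite -subr_eq0 -normr_eq0 ?[`|_|]er_0 ?[`|_|]ep_0.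
Qed.

End Phase.

(** * Moduli, symmetry and simplicity of the roots of the spectral polynomial *)

Section SpectralPolynomial.
Variables (R : realType) (a : R) (N : nat).
Hypothesis a01 : 0 < a < 1.
Implicit Types (r phi : R) (w : R[i]).

Let b := (1 + a) / 2.
Let d := 1 - b.
(** The degree is [m.+1], the [n] of the overview; [m] itself is the denominator in the sines of the
    theorem. *)
Let m := (4 * N + 5)%N.
Local Notation normc := (@ComplexField.Normc.normc R).

Hypothesis m_large : 340 / d ^+ 6 < m%:R.

(* Up to the factor [w ^+ 2 + 1] and a power of [w], the characteristic polynomial
   of the scheme at [lambda = (c / h) (w - 1 / w)]. *)
Definition spectral_poly : {poly R[i]} :=
  'X^((4 * N + 5).+1) + a%:C *: 'X^(4 * N + 5) - a%:C *: 'X + 1.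

Lemma spectral_rootE w :
  root spectral_poly w = (w ^+ m.+1 + a%:C * w ^+ m - a%:C * w + 1 == 0).
Proof. by rewrite rootE /spectral_poly !hornerE. Qed.

Lemma spectral_root_neq0 w : root spectral_poly w -> w != 0.
Proof.
apply: contraTneq => ->.
have m0 : (4 * N + 5 = (4 * N + 4).+1)%N by rewrite addnS.
by rewrite spectral_rootE /m m0 !exprS !mul0r !mulr0 subr0 !add0r oner_eq0.
Qed.

(* The involution [w -> - 1 / w] preserves [w - 1 / w], hence the eigenvalue. *)
Lemma spectral_root_opp_inv w : root spectral_poly w -> root spectral_poly (- w^-1).
Proof.
move=> rw; have w0 := spectral_root_neq0 rw; move: rw; rewrite !spectral_rootE => /eqP rw.
have -> : (- w^-1) ^+ m.+1 = w^-1 ^+ m.+1.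
  by rewrite exprNn -signr_odd /m /= oddD oddM /= mul1r.
have -> : (- w^-1) ^+ m = - w^-1 ^+ m.
  by rewrite exprNn -signr_odd /m /= oddD oddM /= expr1 mulN1r.
(* As [m] is odd, the value at [- 1 / w] is the value at [w] divided by [w ^+ m.+1]. *)
apply/eqP; transitivity (w^-1 ^+ m.+1 * (w ^+ m.+1 + a%:C * w ^+ m - a%:C * w + 1)).
  rewrite !exprS !exprVn.
  by field; rewrite expf_neq0 ?w0.
by rewrite rw mulr0.
Qed.

Lemma normc_real (x : R) : normc x%:C = `|x|.
Proof. by rewrite /= expr0n addr0 sqrtr_sqr. Qed.

Lemma normc_ge0 w : 0 <= normc w.
Proof. by case: w => x y; rewrite /= sqrtr_ge0. Qed.

Lemma normcX w n : normc (w ^+ n) = normc w ^+ n.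
Proof.
elim: n => [|n IH]; first by rewrite !expr0 normc_real normr1.
by rewrite !exprS ComplexField.Normc.normcM -IH.
Qed.

Lemma normcB_ge w z : normc w - normc z <= normc (w + z).
Proof.
by have := le_normcD (w + z) (- z); rewrite addrK normcN lerBlDr.
Qed.

Lemma d_bounds : [/\ 0 < d, d <= 1 / 2 & a = 1 - 2 * d].
Proof. have /andP[a0 a1] := a01; rewrite /d /b; split; lra. Qed.

Lemma m_bounds : [/\ 0 < m%:R :> R, 2 / d ^+ 2 < m%:R & (d * m%:R)^-1 <= d].
Proof.
have [d0 d1 _] := d_bounds.
have h : 340 / d ^+ 2 < m%:R.
  apply: le_lt_trans m_large; rewrite ler_pM2l// lef_pV2 ?posrE ?exprn_gt0//.
  by rewrite ler_wiXn2l// ?ltW//; lra.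
have m0 : 0 < m%:R :> R by apply: le_lt_trans h; rewrite divr_ge0 ?exprn_ge0 ?ltW.
have h2 : 2 / d ^+ 2 < m%:R.
  by apply: le_lt_trans h; rewrite ler_pM2r ?invr_gt0 ?exprn_gt0//; lra.
split=> //; rewrite invf_ple ?posrE ?mulr_gt0// -ler_pdivrMl// -invfM -expr2.
apply: ltW; apply: le_lt_trans h2; rewrite -[leLHS]mul1r ler_pM2r ?invr_gt0 ?exprn_gt0//; lra.
Qed.

(** For [r = |w| > 1], the equation [w ^+ m * (w + a) = a w - 1] gives
    [r ^+ m <= (a r + 1) / (r - a) <= 1 / d], and Bernoulli's inequality converts this into a bound
    on [r - 1]. *)
Lemma spectral_root_normc w : root spectral_poly w -> normc w <= 1 + (d * m%:R)^-1.
Proof.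
move=> rw; have w0 := spectral_root_neq0 rw; move: rw; rewrite spectral_rootE => /eqP rw.
have [d0 d1 aE] := d_bounds; have [m0 _ _] := m_bounds.
have /andP[a0 a1] := a01.
have e0 : 0 < (d * m%:R)^-1 by rewrite invr_gt0 mulr_gt0.
have [r1|/ltW r1] := leP (normc w) 1; first by lra.
have E : w ^+ m * (w + a%:C) = a%:C * w - 1.
  by apply/eqP; rewrite -subr_eq0 -rw exprS; apply/eqP; ring.
have h1 : normc w ^+ m * (normc w - a) <= a * normc w + 1.
  have <- : normc a%:C = a by rewrite normc_real gtr0_norm.
  rewrite -ComplexField.Normc.normcM.
  apply: (@le_trans _ _ (normc (a%:C * w - 1))); last first.
    by rewrite (le_trans (le_normcD _ _))// normcN (normc_real 1) normr1.
  rewrite -E [leRHS]ComplexField.Normc.normcM normcX ler_wpM2l ?normcB_ge//.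
  by rewrite exprn_ge0// (le_trans ler01).
have h2 := bernoulli m r1; set r := normc w in r1 h1 h2 *.
have h3 : 1 + m%:R * (r - 1) <= 1 / d.
  rewrite ler_pdivlMr//; apply: le_trans (_ : r ^+ m * d <= _).
    by rewrite ler_pM2r.
  have ra : 0 < r - a by lra.
  rewrite -(ler_pM2r ra) mulrAC.
  have h4 := ler_wpM2r (ltW d0) h1.
  apply: le_trans h4 _.
  by rewrite aE; nra.
have h4 : m%:R * (r - 1) <= d^-1 by rewrite mul1r in h3; lra.
by rewrite invfM -lerBlDl ler_pdivlMr// mulrC.
Qed.

Lemma spectral_root_normc_inv w : root spectral_poly w -> (normc w)^-1 <= 1 + (d * m%:R)^-1.
Proof.
move=> /spectral_root_opp_inv/spectral_root_normc.
by rewrite normcN ComplexField.Normc.normcV.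
Qed.

Lemma spectral_root_admissible w : root spectral_poly w -> admissible a (normc w).
Proof.
move=> rw; have h1 := spectral_root_normc rw; have h2 := spectral_root_normc_inv rw.
have [d0 d1 aE] := d_bounds; have [m0 _ h3] := m_bounds.
have /andP[a0 a1] := a01.
have r0 : 0 < normc w.
  rewrite lt0r normc_ge0 andbT; apply: contraNneq (spectral_root_neq0 rw).
  by move/ComplexField.Normc.eq0_normc => ->.
have bE : (1 + a) / 2 = 1 - d by rewrite /d /b; lra.
have s0 : 0 < (normc w)^-1 by rewrite invr_gt0.
rewrite /admissible bE; split=> //.
(* Since [(d m)^-1 <= d], the product is at most [(1 - 2 d) (1 + d) <= 1 - d], which is [b]. *)
- apply: le_trans (ler_wpM2l (ltW a0) h1) _; rewrite aE; nra.
- apply: le_trans (ler_wpM2l (ltW a0) h2) _; rewrite aE; nra.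
- lra.
- lra.
Qed.

Lemma spectral_root_factored w : root spectral_poly w ->
  w ^+ (4 * N + 6) * (1 + a%:C / w) = - (1 - a%:C * w).
Proof.
move=> rw; have w0 := spectral_root_neq0 rw; move: rw; rewrite spectral_rootE => /eqP rw.
have -> : (4 * N + 6 = m.+1)%N by rewrite /m; lia.
apply/eqP; rewrite -subr_eq0 -rw exprS; apply/eqP; field.
exact: w0.
Qed.

(** At a double root, eliminating [w ^+ m] gives [w ^+ m.+1 = m - (m - 1) a w], of modulus at least
    [m d]. The factored equation bounds the same modulus by [2 / d], contradicting
    [2 / d ^+ 2 < m]. *)
Lemma spectral_root_simple w : root spectral_poly w -> ~~ root spectral_poly^`() w.
Proof.
move=> rw; have w0 := spectral_root_neq0 rw; apply/negP => rw'.
have [r0 ar as' _ _] := spectral_root_admissible rw.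
have [d0 d1 aE] := d_bounds; have [m0 m2 _] := m_bounds.
have /andP[a0 a1] := a01.
have fac := spectral_root_factored rw.
have bE : (1 + a) / 2 = 1 - d by rewrite /d /b; lra.
rewrite bE in ar as'.
have na : normc a%:C = a by rewrite normc_real gtr0_norm.
have n1 : normc 1 = 1 by rewrite (normc_real 1) normr1.
have up : normc (w ^+ m.+1) * d <= 2.
  have h1 : d <= normc (1 + a%:C / w).
    have := normcB_ge 1 (a%:C / w).
    by rewrite ComplexField.Normc.normcM na ComplexField.Normc.normcV n1 ; lra.
  apply: (@le_trans _ _ (normc (w ^+ m.+1) * normc (1 + a%:C / w))).
    by rewrite ler_wpM2l// normc_ge0.
  rewrite -ComplexField.Normc.normcM -[m.+1]addn1 /m -addnA fac normcN.
  rewrite (le_trans (le_normcD _ _))// normcN ComplexField.Normc.normcM na n1.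
  lra.
have E : w ^+ m.+1 = m%:R - (m%:R - 1) * (a%:C * w).
  move: rw; rewrite spectral_rootE => /eqP rw.
  move: rw'; rewrite rootE /spectral_poly -polyC1.
  rewrite !(derivD, derivB, derivZ, derivXn, derivX, derivC, derivN).
  rewrite !(hornerE, hornerMn) -!(mulr_natr (_ ^+ _)) /= => /eqP rw'.
  have mE : m = (4 * N + 4).+1 by rewrite /m addnS.
  (* The two zeros are rewritten backwards into the values at [w] of the derivative and of the
     polynomial, which performs the elimination. *)
  have : w * 0 - m%:R * 0 = 0 :> R[i] by rewrite !mulr0 subrr.
  rewrite -[X in w * X]rw' -[X in m%:R * X]rw -/m mE /= -!natr1 !exprS => H.
  apply/eqP; rewrite -subr_eq0 -H; apply/eqP; ring.
have lo : m%:R * d <= normc (w ^+ m.+1).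
  have nm (n : nat) : normc n%:R = n%:R.
    by rewrite -[n%:R](rmorph_nat (real_complex R)) normc_real normr_nat.
  rewrite E; apply: le_trans (normcB_ge _ _).
  have mE : m = (4 * N + 4).+1 by rewrite /m addnS.
  have -> : m%:R - 1 = (4 * N + 4)%:R :> R[i] by rewrite mE -natr1 addrK.
  rewrite normcN !ComplexField.Normc.normcM na !nm mE -natr1.
  have := ler_wpM2l (ler0n R (4 * N + 4)) ar; lra.
have := ler_wpM2r (ltW d0) lo => /le_trans/(_ up).
by rewrite -mulrA -expr2 -ler_pdivlMr ?exprn_gt0// leNgt m2.
Qed.

End SpectralPolynomial.

(** * Arguments in the right half-plane and numbering of the branches *)

Section RightHalfPlane.
Variable R : realType.

Definition right_arg (w : R[i]) := atan (complex.Im w / complex.Re w).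

Lemma right_polar (w : R[i]) : 0 < complex.Re w ->
  w = (ComplexField.Normc.normc w)%:C * cis (right_arg w).
Proof. by case: w => x y /= x0; exact: polar_right_half_plane. Qed.

End RightHalfPlane.

(** Carries the indices [0, ..., 2 N + 1] to the branches [- N - 1, ..., N]. *)
Definition branch (N i : nat) : int := i%:Z - N.+1%:Z.

Lemma branch_surj (N : nat) (k : int) : - N.+3%:Z < k -> k < N.+2%:Z ->
  k != N.+1%:Z -> k != - N.+2%:Z -> exists2 i, (i < 2 * N + 2)%N & branch N i = k.
Proof.
rewrite /branch => h1 h2 h3 h4.
by exists (absz (k + N.+1%:Z)); lia.
Qed.

(** * Counting the roots in the right half-plane: one on each branch *)

Section RootCount.
Variables (R : realType) (a : R) (N : nat).
Hypothesis a01 : 0 < a < 1.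
Implicit Types (r phi : R) (w : R[i]).

Let d := 1 - (1 + a) / 2.
Hypothesis m_large : 340 / d ^+ 6 < (4 * N + 5)%:R.
Local Notation normc := (@ComplexField.Normc.normc R).
Local Notation F := (spectral_poly a N).

Lemma size_spectral_poly : size F = (4 * N + 7)%N.
Proof.
rewrite /spectral_poly -!addrA size_polyDl size_polyXn; first by lia.
rewrite (leq_ltn_trans (size_polyD _ _))// gtn_max.
rewrite (leq_ltn_trans (size_scale_leq _ _)) ?size_polyXn//=.
rewrite (leq_ltn_trans (size_polyD _ _))// gtn_max size_polyN size_poly1.
by rewrite (leq_ltn_trans (size_scale_leq _ _)) ?size_polyX//; lia.
Qed.

(** At [w = i s] the odd powers of [w] are imaginary, so the real part of the equation reads
    [(- s ^+ 2) ^+ (2 N + 3) + 1 = 0], forcing [s ^+ 2 = 1]. *)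
Lemma spectral_root_imag w : root F w -> complex.Re w = 0 -> w \in [:: 'i%C; - 'i%C].
Proof.
rewrite spectral_rootE => /eqP; case: w => x s /= + x0; subst x => rw.
have w2 : (0 +i* s) ^+ 2 = (- s ^+ 2)%:C.
  by rewrite expr2; simpc; rewrite expr2.
have {}rw : (- s ^+ 2) ^+ (2 * N + 3) + 1 = 0.
  move: rw; rewrite (_ : (4 * N + 5).+1 = (2 * (2 * N + 3))%N); last by lia.
  rewrite (_ : (4 * N + 5)%N = (2 * (2 * N + 2)).+1); last by lia.
  rewrite [_ ^+ _.+1]exprS !exprM w2 -!rmorphXn /=.
  by move/(congr1 (@complex.Re R)); simpc => /= ->.
have s1 : s ^+ 2 = 1.
  have k0 : (0 < 2 * N + 3)%N by rewrite addnS.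
  apply/eqP; rewrite -(@pexpr_eq1 _ _ _ k0) ?sqr_ge0//.
  move/eqP: rw; rewrite exprNn -signr_odd oddD oddM /= expr1 mulN1r addrC subr_eq0.
  by rewrite eq_sym => ->.
rewrite !inE -eqf_sqr w2 s1 -[X in _ == X]/('i%C ^+ 2) sqr_i.
by rewrite rmorphN rmorph1.
Qed.

Lemma spectral_roots_uniq (ws : seq R[i]) : F %= \prod_(w <- ws) ('X - w%:P) -> uniq ws.
Proof.
move=> FE; apply/negPn/negP => /(uniqPn 0)[i [j [ltij ltj eqij]]].
pose w := ws`_i; have lti := ltn_trans ltij ltj.
have rw : root F w by rewrite (eqp_root FE) root_prod_XsubC mem_nth.
have : ('X - w%:P) ^+ 2 %| F.
  rewrite (eqp_dvdr _ FE) (big_nth 0) big_mkord.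
  rewrite (bigD1 (Ordinal lti))//= (bigD1 (Ordinal ltj))/=; last first.
    by rewrite -val_eqE/= neq_ltn ltij orbT.
  by rewrite -eqij mulrA -expr2 dvdp_mulr.
move=> /dvdpP[q FqE]; have := spectral_root_simple a01 m_large rw.
by rewrite FqE derivM deriv_exp rootE !hornerE subrr /= !(mulr0, addr0) eqxx.
Qed.

Lemma re_opp_inv w : w != 0 -> (complex.Re (- w^-1) > 0) = (complex.Re w < 0).
Proof.
case: w => x y w0 /=.
have h : 0 < x ^+ 2 + y ^+ 2.
  rewrite lt0r addr_ge0 ?sqr_ge0// andbT; apply: contraNneq w0 => /eqP.
  by rewrite paddr_eq0 ?sqr_ge0// !sqrf_eq0 => /andP[/eqP-> /eqP->].
by rewrite oppr_gt0 pmulr_llt0 ?invr_gt0.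
Qed.

Lemma exists_spectral_roots : exists ws : seq R[i],
  [/\ uniq ws, (2 * N + 2 <= size ws)%N
    & forall w, w \in ws -> root F w /\ 0 < complex.Re w].
Proof.
have F0 : F != 0 by rewrite -size_poly_gt0 size_spectral_poly addnS.
have [rs FE] := closed_field_poly_normal F.
have rsF w : (w \in rs) = root F w.
  by rewrite FE rootZ ?lead_coef_eq0// root_prod_XsubC.
have rs_uniq : uniq rs.
  by apply: spectral_roots_uniq; rewrite {1}FE eqp_scale// lead_coef_eq0.
have rs_size : size rs = (4 * N + 6)%N.
  have := size_spectral_poly.
  by rewrite FE size_scale ?lead_coef_eq0// size_prod_XsubC => -[]; lia.
pose P w := 0 < complex.Re w; pose M w := complex.Re w < 0; pose I (w : R[i]) := complex.Re w == 0.
exists [seq w <- rs | P w]; split.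
- by rewrite filter_uniq.
- have szM : (size [seq w <- rs | M w] <= size [seq w <- rs | P w])%N.
    rewrite -(size_map (fun w => - w^-1)); apply: uniq_leq_size.
      by rewrite map_inj_uniq ?filter_uniq// => x y /oppr_inj /invr_inj.
    move=> _ /mapP[w + ->]; rewrite !mem_filter !rsF => /andP[Mw rw].
    by rewrite /P re_opp_inv ?(spectral_root_neq0 rw)// [_ < 0]Mw spectral_root_opp_inv.
  have szI : (size [seq w <- rs | I w] <= 2)%N.
    rewrite -[2%N]/(size [:: 'i%C : R[i]; - 'i%C]); apply: uniq_leq_size.
      by rewrite filter_uniq.
    by move=> w; rewrite mem_filter rsF => /andP[/eqP w0 rw]; apply: spectral_root_imag.
  (* By trichotomy of the real part, [4 N + 6 = P + M + I <= 2 P + 2] for the three counts. *)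
  have : size rs = (size [seq w <- rs | P w] + (size [seq w <- rs | M w] +
      size [seq w <- rs | I w]))%N.
    rewrite !size_filter -(count_predC P); congr (_ + _)%N.
    rewrite -count_predUI [X in (_ = _ + X)%N](_ : _ = 0%N); last first.
      by apply/eqP; rewrite -leqn0 leqNgt -has_count; apply/hasPn => w _ /=;
        rewrite /M /I negb_and; case: ltgtP.
    by rewrite addn0; apply: eq_count => w /=; rewrite /P /M /I; case: ltgtP.
  by rewrite rs_size; lia.
- by move=> w; rewrite mem_filter rsF => /andP[].
Qed.

Lemma factor_arg_bound r phi : `|factor_arg a r phi| < pi / 2.
Proof. by rewrite ltr_norml atan_gtNpi2 atan_ltpi2. Qed.

Lemma spectral_root_branch w : root F w -> 0 < complex.Re w ->
  exists2 i, (i < 2 * N + 2)%N &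
    polar_root a (4 * N + 6) (branch N i) (normc w) (right_arg w).
Proof.
move=> rw w0; have wE := right_polar w0.
have adm := spectral_root_admissible a01 m_large rw.
have := atan_gtNpi2 (complex.Im w / complex.Re w).
have := atan_ltpi2 (complex.Im w / complex.Re w).
rewrite -/(right_arg w); set phi := right_arg w in wE *; set r := normc w in adm wE *.
move=> p2 p1.
have [k hk] : exists k, polar_root a (4 * N + 6) k r phi.
  apply: (exists_polar_root a01 adm); rewrite -wE; exact: spectral_root_factored.
have pi0 := @pi_gt0 R.
have n_large : 340 / d ^+ 6 < (4 * N + 6)%:R.
  by apply: lt_le_trans m_large _; rewrite ler_nat; lia.
have nE : (4 * N + 6)%:R = 4 * N%:R + 6 :> R by rewrite natrD natrM.
have N1E : N.+1%:Z%:~R = N%:R + 1 :> R by rewrite natr1.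
have N2E : N.+2%:Z%:~R = N%:R + 2 :> R by rewrite -natrD addn2.
have N3E : N.+3%:Z%:~R = N%:R + 3 :> R by rewrite -natrD addn3.
have adm1 : admissible a 1.
  by have /andP[a0 a1] := a01; rewrite /admissible invr1 mulr1; split; lra.
(* The point [i], with [r = 1] and [phi = pi / 2], lies on this branch: [pi - phi = phi] cancels the
   factor arguments and [n pi / 2 = pi + 2 pi (N + 1)]. Uniqueness on a branch would then put [w] on
   the imaginary axis. The next exclusion does the same with [- i]. *)
have kN1 : k != N.+1%:Z.
  apply/eqP => kE; rewrite kE in hk.
  have h : polar_root a (4 * N + 6) N.+1%:Z 1 (pi / 2).
    rewrite /polar_root invr1 expr1n mul1r (_ : pi - pi / 2 = pi / 2); last by lra.
    split=> //; rewrite addrK nE N1E; lra.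
  have [_] := polar_root_inj a01 n_large adm adm1 hk h.
  by move=> E; rewrite E ltxx in p2.
have kN2 : k != - N.+2%:Z.
  apply/eqP => kE; rewrite kE in hk.
  have h : polar_root a (4 * N + 6) (- N.+2%:Z) 1 (- (pi / 2)).
    have cE : cos (pi - - (pi / 2)) = cos (- (pi / 2)) :> R.
      by rewrite opprK addrC cosDpi cosN cos_pihalf oppr0.
    have sE : sin (pi - - (pi / 2)) = sin (- (pi / 2)) :> R.
      by rewrite opprK addrC sinDpi sinN.
    rewrite /polar_root invr1 expr1n mul1r /factor_sqnorm /factor_arg cE sE.
    split=> //; rewrite addrK nE intrN N2E; lra.
  have [_] := polar_root_inj a01 n_large adm adm1 hk h.
  by move=> E; rewrite E ltxx in p1.
have [_ hp] := hk.
have := factor_arg_bound r phi; have := factor_arg_bound r^-1 (pi - phi).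
rewrite !ltr_norml => /andP[b1 b2] /andP[b3 b4].
have n0 : 0 < (4 * N + 6)%:R :> R by rewrite ltr0n addnS.
have q1 := ltr_pM2l n0 (- (pi / 2)) phi; rewrite p1 in q1.
have q2 := ltr_pM2l n0 phi (pi / 2); rewrite p2 in q2.
(* With [phi < pi / 2] and both factor arguments below [pi / 2] in absolute value,
   [pi (2 k + 1) < (2 N + 4) pi]. *)
have kub : k < N.+2%:Z.
  rewrite -(ltr_int R) -(ltr_pM2l pi0) N2E.
  by move: q2; rewrite nE => /idP; rewrite nE in hp; lra.
have klb : - N.+3%:Z < k.
  rewrite -(ltr_int R) -(ltr_pM2l pi0) intrN N3E.
  by move: q1; rewrite nE => /idP; rewrite nE in hp; lra.
have [i lti iE] := branch_surj klb kub kN1 kN2.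
by exists i; rewrite ?iE.
Qed.

(** Pigeonhole: roots on the same branch coincide, so at least [2 N + 2] distinct roots inject into
    [2 N + 2] indices and every index is attained. *)
Lemma exists_spectral_root_branch i : (i < 2 * N + 2)%N ->
  exists w, [/\ root F w, 0 < complex.Re w
    & polar_root a (4 * N + 6) (branch N i) (normc w) (right_arg w)].
Proof.
move=> lti; have [ws [ws_uniq ws_size wsP]] := exists_spectral_roots.
have /choice[f fP] (w : R[i]) : exists j, w \in ws -> (j < 2 * N + 2)%N /\
    polar_root a (4 * N + 6) (branch N j) (normc w) (right_arg w).
  case: (boolP (w \in ws)) => [/wsP[rw w0]|_]; last by exists 0%N.
  by have [j ltj hj] := spectral_root_branch rw w0; exists j.
have n_large : 340 / d ^+ 6 < (4 * N + 6)%:R.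
  by apply: lt_le_trans m_large _; rewrite ler_nat; lia.
have f_inj : {in ws &, injective f}.
  move=> w1 w2 h1 h2 fE.
  have [r1 re1] := wsP _ h1; have [r2 re2] := wsP _ h2.
  have [_ p1] := fP _ h1; have [_ p2] := fP _ h2.
  rewrite fE in p1.
  have [nE phiE] := polar_root_inj a01 n_large (spectral_root_admissible a01 m_large r1)
    (spectral_root_admissible a01 m_large r2) p1 p2.
  by rewrite (right_polar re1) (right_polar re2) nE phiE.
have : i \in map f ws.
  have [] := @uniq_min_size _ (map f ws) (iota 0 (2 * N + 2)).
  - by rewrite map_inj_in_uniq.
  - by move=> _ /mapP[w hw ->]; rewrite mem_iota; case: (fP _ hw).
  - by rewrite size_iota size_map.
  by move=> _ ->; rewrite mem_iota.
case/mapP => w hw ->; have [rw w0] := wsP _ hw; have [_ p] := fP _ hw.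
by exists w.
Qed.

End RootCount.

(** * From roots of the spectral polynomial to eigenvalues of the matrix *)

Section Eigenvectors.
Variables (R : realType) (c L xi : R) (N : nat).
Hypotheses (c_gt0 : 0 < c) (L_gt0 : 0 < L).
Let h := mesh L N.
Let a := xi / c.
Local Notation toC := (real_complex R).

Lemma mesh_gt0 : 0 < h.
Proof. by rewrite divr_gt0. Qed.

Lemma sum_mul_indicator (K : nzRingType) (n k : nat) (f : nat -> K) :
  \sum_(i < n) f i * (i == k :> nat)%:R = if (k < n)%N then f k else 0.
Proof.
rewrite -(big_ord1_eq +%R f k n) [RHS]big_mkcond; apply: eq_bigr => i _.
by case: eqP; rewrite ?mulr1 ?mulr0.
Qed.

(** Position [i] holds the value at node [i + 1]; the fixed end [f 0 = 0] lets the first column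
    follow the interior formula. *)
Lemma sum_mul_tridiagonal (K : comNzRingType) (f : nat -> K) (j : 'I_N.+1) : f 0%N = 0 ->
  \sum_(i < N.+1) f i.+1 *
      (if i == j then (if i == ord_max then 1 else 2)
       else if (i.+1 == j :> nat) || (j.+1 == i :> nat) then -1 else 0)
  = if j == ord_max then f N.+1 - f N else 2 * f j.+1 - f j - f j.+2.
Proof.
move=> f0; pose t : K := if j == ord_max then 1 else 2.
transitivity (\sum_(i < N.+1) (t * (f i.+1 * (i == j :> nat)%:R)
    - f i.+1 * (i.+1 == j :> nat)%:R - f i.+1 * (i == j.+1 :> nat)%:R)).
  apply: eq_bigr => i _; rewrite /t -!val_eqE /= (eq_sym j.+1).
  have [ij|ij] := eqVneq (i : nat) j.
    have -> : (i.+1 == j :> nat) = false by apply/eqP; lia.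
    have -> : (i == j.+1 :> nat) = false by apply/eqP; lia.
    by rewrite ij /= mulr1 !mulr0 !subr0 mulrC.
  have [ij1|ij1] := eqVneq i.+1 (j : nat).
    have -> : (i == j.+1 :> nat) = false by apply/eqP; lia.
    by rewrite /= mulrN1 !mulr0 mulr1 subr0 sub0r.
  by case: eqP => _ /=; rewrite ?mulrN1 !mulr0 ?mulr1 ?subr0 ?sub0r.
rewrite !sumrB -mulr_sumr (sum_mul_indicator N.+1 j (fun i => f i.+1)) ltn_ord.
rewrite (sum_mul_indicator N.+1 j.+1 (fun i => f i.+1)).
have -> : \sum_(i < N.+1) f i.+1 * (i.+1 == j :> nat)%:R = f j.
  case: j t => -[|j] /= ltj _; first by rewrite big1 // => i _; rewrite mulr0.
  by rewrite (sum_mul_indicator N.+1 j (fun i => f i.+1)) ltnW.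
rewrite /t -val_eqE /=; case: eqP => [->|jN]; first by rewrite ltnn mul1r subr0.
by have -> : (j.+1 < N.+1)%N by have := ltn_ord j; lia.
Qed.

Definition wave_eigenvalue (w : R[i]) : R[i] := (c / h)%:C * (w - w^-1).

(** The difference of the values [w - 1 / w] factors as [(w1 - w2) (1 + 1 / (w1 w2))]; the second
    factor vanishes only if [w1 = - 1 / w2], which lies in the opposite half-plane. *)
Lemma wave_eigenvalue_inj (w1 w2 : R[i]) :
  0 < complex.Re w1 -> 0 < complex.Re w2 ->
  wave_eigenvalue w1 = wave_eigenvalue w2 -> w1 = w2.
Proof.
move=> p1 p2 E; have q0 : (c / h)%:C != 0.
  by rewrite (inj_eq (@complexI R)) gt_eqF// divr_gt0// mesh_gt0.
have {E} := mulfI q0 E => E.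
have n1 : w1 != 0 by apply: contraTneq p1 => ->; rewrite ltxx.
have n2 : w2 != 0 by apply: contraTneq p2 => ->; rewrite ltxx.
have : (w1 - w2) * (1 + w1^-1 * w2^-1) = 0.
  have -> : (w1 - w2) * (1 + w1^-1 * w2^-1) = (w1 - w1^-1) - (w2 - w2^-1).
    by field; rewrite n1 n2.
  by rewrite E subrr.
move/eqP; rewrite mulf_eq0 subr_eq0 => /orP[/eqP//|/eqP E1].
have E2 : w1 = - w2^-1.
  by apply/eqP; rewrite -subr_eq0 opprK -(mulr0 w1) -E1 mulrDr mulr1 mulrA divff// mul1r.
by rewrite E2 re_opp_inv// ltNge ltW in p1.
Qed.

Lemma wave_eigenvalueP (w : R[i]) : root (spectral_poly a N) w -> 0 < complex.Re w ->
  eigenvalue (map_mx toC (FD_matrix c L xi N)) (wave_eigenvalue w).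
Proof.
move=> rw re_w; have w0 := spectral_root_neq0 rw.
(* Left eigenvectors [(v1, v2)] satisfy [v1 = lambda v2 - v2 B]; the interior
   equations and [v_0 = 0] force [v2] up to a scalar. *)
pose g k := w ^+ (2 * k) - w^-1 ^+ (2 * k).
pose v2 : 'rV[R[i]]_N.+1 := \row_(i < N.+1) g i.+1.
set lam := wave_eigenvalue w.
pose S := map_mx toC (FD_stiffness c L N); pose B := map_mx toC (FD_damping L xi N).
pose q : R[i] := (c / h)%:C.
have g0 : g 0%N = 0 by rewrite /g !expr0 subrr.
have v2S j : (v2 *m S) 0 j =
    q ^+ 2 * if j == ord_max then g N.+1 - g N else 2 * g j.+1 - g j - g j.+2.
  rewrite -(sum_mul_tridiagonal j g0) mulr_sumr mxE; apply: eq_bigr => i _.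
  rewrite !mxE /= rmorphM mulrCA; congr (_ * _).
    by rewrite -expr_div_n rmorphXn.
  by case: ifP => _; [case: ifP => _|case: ifP => _];
    rewrite ?rmorphN ?rmorph1 ?rmorph0 ?rmorph_nat.
have v2B j : (v2 *m B) 0 j = if j == ord_max then - (a%:C * q) * g N.+1 else 0.
  rewrite mxE (bigD1 ord_max)//= big1 ?addr0; last first.
    by move=> i /negPf iN; rewrite !mxE iN /= rmorph0 mulr0.
  rewrite !mxE eqxx /=; case: ifP => _; last by rewrite rmorph0 mulr0.
  rewrite mulrC /q -rmorphM -rmorphN; congr (_%:C * _).
  by rewrite /a -/h; field; rewrite !gt_eqF ?mesh_gt0.
apply/eigenvalueP; exists (row_mx (lam *: v2 - v2 *m B) v2).
  rewrite map_block_mx map_mx0 map_mx1 map_mxN mul_row_block -/S -/B.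
  rewrite mulmx0 add0r mulmx1 subrK scale_row_mx; congr row_mx.
  apply/rowP => j.
  have -> : (lam *: (lam *: v2 - v2 *m B)) 0 j = lam * (lam * g j.+1 - (v2 *m B) 0 j).
    by rewrite !mxE.
  rewrite mulmxN [LHS]mxE v2S v2B /lam /wave_eigenvalue -/q; clearbody q.
  have gE k : g k = w ^+ (2 * k) - (w ^+ (2 * k))^-1 by rewrite /g exprVn.
  have uS k : w ^+ (2 * k.+1) = w ^+ (2 * k) * w ^+ 2 by rewrite mulnS exprD mulrC.
  have u0 k : w ^+ (2 * k) != 0 by rewrite expf_neq0.
  (* The interior columns are identities in [w]. In the boundary column the residual is a multiple
     of the spectral polynomial at [w]. *)
  case: eqP => [->|_]; rewrite !gE !uS; last first.
    by have := u0 j; set u := w ^+ (2 * j) => uj; field; rewrite w0 uj.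
  have uN := u0 N; set u := w ^+ (2 * N) in uN *.
  apply/eqP; rewrite -subr_eq0; apply/eqP.
  transitivity (- (q ^+ 2 * (w - w^-1) * (u^-1 * w^-1 ^+ 3)) *
    (u ^+ 2 * w ^+ 6 + a%:C * (u ^+ 2 * w ^+ 5) - a%:C * w + 1)).
    by rewrite /=; field; rewrite w0 uN.
  move: rw; rewrite spectral_rootE => /eqP rw.
  rewrite /u -!exprM -!exprD (_ : (2 * N * 2 + 6 = (4 * N + 5).+1)%N); last by lia.
  by rewrite (_ : (2 * N * 2 + 5 = 4 * N + 5)%N) ?rw ?mulr0//; lia.
(* A vanishing eigenvector would give [g 1 = 0], so [w ^+ 4 = 1]; but [1] is not a root, and [-1],
   [i], [- i] have no positive real part. *)
apply/eqP => /(congr1 rsubmx); rewrite row_mxKr => /rowP/(_ ord0).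
rewrite !mxE /g /= muln1 => w4.
have : (w - 1) * (w + 1) * (w ^+ 2 - 'i%C ^+ 2) = 0.
  have -> : (w - 1) * (w + 1) * (w ^+ 2 - 'i%C ^+ 2) = w ^+ 2 * (w ^+ 2 - w^-1 ^+ 2).
    by rewrite sqr_i; field.
  by rewrite w4 mulr0.
move/eqP; rewrite !mulf_eq0 !subr_eq0 eqf_sqr => /orP[/orP[]|/orP[]] /eqP wE.
- move: rw; rewrite spectral_rootE wE !expr1n !mulr1 addrK.
  by rewrite -(natrD _ 1 1) pnatr_eq0.
- by move: re_w; rewrite (eqP (etrans (esym (addr_eq0 _ _)) (introT eqP wE))) /= ltr0N1.
- by move: re_w; rewrite wE /= ltxx.
- by move: re_w; rewrite wE /= oppr0 ltxx.
Qed.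

End Eigenvectors.

(** * Asymptotics of the phases, moduli and eigenvalues *)

Section Asymptotics.
Variables (R : realType) (N : nat).
Implicit Types (a c L r phi : R) (w : R[i]) (j : nat).
Local Notation normc := (@ComplexField.Normc.normc R).
Local Notation n := (4 * N + 6)%N.

Lemma polar_root_phase a (k : int) r phi : polar_root a n k r phi ->
  `|phi - pi * (2 * k%:~R + 1) / n%:R| <= pi / n%:R.
Proof.
move=> [_]; have : 0 < n%:R :> R by rewrite ltr0n addnS.
move: n%:R => nr n0 hp; have b1 := factor_arg_bound a r phi.
have b2 := factor_arg_bound a r^-1 (pi - phi).
have -> : phi - pi * (2 * k%:~R + 1) / nr =
    (factor_arg a r phi - factor_arg a r^-1 (pi - phi)) / nr.
  have -> : pi * (2 * k%:~R + 1) = pi + 2 * pi * k%:~R :> R by ring.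
  by rewrite -hp; field; rewrite gt_eqF.
rewrite normrM normfV (gtr0_norm n0) ler_pM2r ?invr_gt0//.
by rewrite (le_trans (ler_normB _ _))//; lra.
Qed.

(* The sines at indices [j > N + 1] repeat those at [j <= N + 1] up to sign and
   [O(1/N)]; they are matched with the branches of negative argument. *)
Definition branch_index j : nat := if (j <= N.+1)%N then (j + N)%N else (j - N.+2)%N.

Lemma branch_index_lt j : (1 <= j <= 2 * N + 2)%N -> (branch_index j < 2 * N + 2)%N.
Proof. rewrite /branch_index; case: ifP; lia. Qed.

Lemma branch_index_inj : {in [pred j | 1 <= j <= 2 * N + 2]%N &, injective branch_index}.
Proof. move=> i j; rewrite !inE /branch_index; case: ifP; case: ifP; lia. Qed.

Lemma sin_phase_dist a r phi j : (1 <= j <= 2 * N + 2)%N ->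
  polar_root a n (branch N (branch_index j)) r phi ->
  `| `|sin phi| - `|sin ((2 * j)%:R * pi / (4 * N + 5)%:R)| | <= 3 * pi / n%:R.
Proof.
move=> j_range /polar_root_phase; set kr := (branch N _)%:~R.
have pi0 := @pi_gt0 R.
have m0 : 0 < (4 * N + 5)%:R :> R by rewrite ltr0n addnS.
have n0 : 0 < n%:R :> R by rewrite ltr0n addnS.
have jm : (2 * j)%:R <= (4 * N + 5)%:R :> R by rewrite ler_nat; lia.
have nE : n%:R = (4 * N + 5)%:R + 1 :> R by rewrite natr1 -addnS.
have mE : (4 * N + 5)%:R = 4 * N%:R + 5 :> R by rewrite natrD natrM.
rewrite natrM in jm *; have j0 : 0 <= j%:R :> R by [].
move: (n%:R : R) ((4 * N + 5)%:R : R) m0 n0 jm nE mE => nr mr m0 n0 jm nE mE.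
set theta := 2 * j%:R * pi / mr.
(* The target angle may be replaced by any [psi] with the same absolute sine; [3 pi] is [pi] for the
   position of [phi] on its branch plus [2 pi] for the change of denominator. *)
have close (psi : R) : `|pi * (2 * kr + 1) / nr - psi| <= 2 * pi / nr ->
    `|phi - pi * (2 * kr + 1) / nr| <= pi / nr ->
    `| `|sin phi| - `|sin psi| | <= 3 * pi / nr.
  move=> h1 h2; rewrite (le_trans (ler_dist_dist _ _))// (le_trans (sin_lipschitz _ _))//.
  rewrite (le_trans (ler_distD (pi * (2 * kr + 1) / nr) _ _))//.
  by rewrite (le_trans (lerD h2 h1))// -mulrDl ler_pM2r ?invr_gt0//; lra.
have small (x : R) : `|x| <= 2 * mr -> `|pi * x / (nr * mr)| <= 2 * pi / nr.
  move=> hx; rewrite normrM normrM normfV (gtr0_norm pi0) (gtr0_norm (mulr_gt0 n0 m0)).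
  rewrite ler_pdivrMr ?mulr_gt0//.
  have -> : 2 * pi / nr * (nr * mr) = pi * (2 * mr) by field; rewrite gt_eqF.
  by rewrite ler_pM2l.
have [jN|jN] := leqP j N.+1.
  have krE : kr = j%:R - 1.
    rewrite /kr /branch /branch_index jN PoszD intrB intrD -!pmulrn -natr1; lra.
  apply: close.
  have -> : pi * (2 * kr + 1) / nr - theta = pi * (- (mr + 2 * j%:R)) / (nr * mr).
    rewrite /theta krE nE; field.
    by rewrite -nE !gt_eqF.
  by apply: small; rewrite normrN ger0_norm; lra.
have krE : kr = j%:R - 2 * N%:R - 3.
  rewrite /kr /branch /branch_index leqNgt jN /= -subzn// !intrB -!pmulrn.
  by rewrite -[N.+2]addn2 -natr1 natrD; lra.
(* Here [2 k + 1 = 2 j - m], so [phi] is close to [theta - pi] rather than to [theta]. *)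
have -> : `|sin theta| = `|sin (theta - pi)|.
  by rewrite -[theta in LHS](subrK pi) sinDpi normrN.
apply: close.
have -> : pi * (2 * kr + 1) / nr - (theta - pi) = pi * (mr - 2 * j%:R) / (nr * mr).
  have -> : 2 * kr + 1 = 2 * j%:R - mr by lra.
  rewrite /theta nE; field.
  by rewrite -nE !gt_eqF.
by apply: small; rewrite ger0_norm; lra.
Qed.

Lemma wave_eigenvalue_polar c L w : 0 < complex.Re w ->
  wave_eigenvalue c L N w =
    (c / mesh L N * ((normc w - (normc w)^-1) * cos (right_arg w))) +i*
    (c / mesh L N * ((normc w + (normc w)^-1) * sin (right_arg w))).
Proof.
move=> re_w; have wE := right_polar re_w.
have w0 : w != 0 by apply: contraTneq re_w => ->; rewrite ltxx.
set r := normc w in wE *; set phi := right_arg w in wE *.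
have r0 : r != 0.
  by apply: contra_neq w0 => r0; rewrite wE r0 mul0r.
have wV : w^-1 = r^-1%:C * cis (- phi).
  apply: (mulfI w0); rewrite divff// {1}wE mulrACA cisN mulr1 -rmorphM divff//.
rewrite /wave_eigenvalue wV wE /cis cosN sinN; simpc.
congr (_ +i* _); ring.
Qed.

Lemma modulus_estimate a w (d := 1 - (1 + a) / 2) : 0 < a < 1 ->
  340 / d ^+ 6 < (4 * N + 5)%:R -> root (spectral_poly a N) w ->
  forall L, 0 < L ->
  `|normc w - (normc w)^-1| <= mesh L N / (2 * d * L) /\
  `|normc w + (normc w)^-1 - 2| <= mesh L N / (2 * d * L).
Proof.
move=> a01 m_large rw L L0.
have h1 := spectral_root_normc a01 m_large rw.
have h2 := spectral_root_normc_inv a01 m_large rw.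
have [r0 _ _ _ _] := spectral_root_admissible a01 m_large rw.
have d0 : 0 < d by have /andP[a0 a1] := a01; rewrite /d; lra.
rewrite -/d in h1 h2; set e := (d * _)^-1 in h1 h2.
have e0 : 0 <= e by rewrite invr_ge0 mulr_ge0 ?(ltW d0).
have s0 : 0 < (normc w)^-1 by rewrite invr_gt0.
set r := normc w in r0 s0 h1 h2 *; set s := r^-1 in s0 h2 *.
have rs : r * s = 1 by rewrite divff// gt_eqF.
have he : 2 * e <= mesh L N / (2 * d * L).
  have : 4 * N.+1%:R <= (4 * N + 5)%:R :> R by rewrite -natrM ler_nat; clear; lia.
  have : 0 < N.+1%:R :> R by rewrite ltr0n.
  rewrite /mesh /e; move: (N.+1%:R : R) ((4 * N + 5)%:R : R) => p q p0 pq.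
  have q0 : 0 < q by lra.
  have -> : L / p / (2 * d * L) = (2 * d * p)^-1 by field; rewrite !gt_eqF.
  have -> : 2 * (d * q)^-1 = (d * q / 2)^-1 by field; rewrite !gt_eqF.
  rewrite lef_pV2 ?posrE ?mulr_gt0 ?invr_gt0//.
  by have := ler_wpM2l (ltW d0) pq; lra.
(* From [r * s = 1] and [s <= 1 + e], since [1 / (1 + e) >= 1 - e]; likewise for [s]. *)
have r1 : 1 - e <= r by nra.
have s1 : 1 - e <= s by nra.
by split; apply: le_trans he; rewrite ler_norml; apply/andP; split; lra.
Qed.

End Asymptotics.

(** * Enumeration of the spectrum and the three bounds *)

Theorem theorem5 (R : realType) (c L xi : R)
    (c_gt0 : 0 < c) (L_gt0 : 0 < L) (xi_gt0 : 0 < xi) (xi_lt_c : xi < c) :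
  exists (K : R) (N0 : nat), forall N : nat, (N0 <= N)%N ->
    let h := mesh L N in
    exists lambda : nat -> R[i],
      eigenvalue_enumeration (FD_matrix c L xi N) lambda /\
      forall j : nat, (1 <= j <= 2 * N + 2)%N ->
        let s := sin ((2 * j)%:R * pi / (4 * N + 5)%:R) in
        [/\ h * `|complex.Re (lambda j)| <= K * h,
            `|h * `|complex.Im (lambda j)| - 2 * c * `|s| | <= K * h
          & h ^+ 2 * ComplexField.Normc.normc (lambda j) ^+ 2
              <= 4 * c ^+ 2 * s ^+ 2 + K * h].
Proof.
pose a := xi / c; pose d := 1 - (1 + a) / 2.
have a01 : 0 < a < 1 by rewrite divr_gt0//= ltr_pdivrMr// mul1r.
have d0 : 0 < d by have /andP[_ a1] := a01; rewrite /d; lra.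
(* The first term comes from the modulus error [h / (2 d L)], the second from twice the sine error
   [3 h / L]. *)
pose K1 := c / (2 * d * L) + 6 * c / L.
have K10 : 0 <= K1 by rewrite addr_ge0// divr_ge0 ?mulr_ge0// ltW.
(* The extra terms come from [(2 c |s| + K1 h) ^+ 2 + (K1 h) ^+ 2]: the cross term is at most
   [4 c K1 h], and each [(K1 h) ^+ 2] is at most [K1 ^+ 2 L h] because [h <= L]. *)
exists (K1 + 4 * c * K1 + 2 * K1 ^+ 2 * L), (Num.truncn (340 / d ^+ 6)).+1 => N N_large h.
have m_large : 340 / d ^+ 6 < (4 * N + 5)%:R.
  apply: lt_le_trans (truncnS_gt _) _; rewrite ler_nat (leq_trans N_large)//.
  by clear; lia.
have h0 : 0 < h := mesh_gt0 N L_gt0.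
have hL : h <= L by rewrite /h /mesh ler_pdivrMr// ler_peMr ?ler1n// ltW.
have /choice[W WP] (j : nat) : exists w : R[i], (1 <= j <= 2 * N + 2)%N ->
    [/\ root (spectral_poly a N) w, 0 < complex.Re w
      & polar_root a (4 * N + 6) (branch N (branch_index N j))
          (ComplexField.Normc.normc w) (right_arg w)].
  case: (boolP (1 <= j <= 2 * N + 2)%N) => [jr|_]; last by exists 0.
  have [w hw] := exists_spectral_root_branch a01 m_large (branch_index_lt jr).
  by exists w.
exists (fun j => wave_eigenvalue c L N (W j)); split.
  pose rs := [seq wave_eigenvalue c L N (W j) | j <- index_iota 1 (N.+1 + N.+1).+1].
  have range j : j \in index_iota 1 (N.+1 + N.+1).+1 -> (1 <= j <= 2 * N + 2)%N.
    by rewrite mem_index_iota; clear; lia.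
  rewrite /eigenvalue_enumeration -(big_map _ xpredT (fun z => 'X - z%:P)) -/rs.
  set p := char_poly _.
  (* The [2 N + 2] eigenvalues found are distinct and match the degree, so they exhaust the
     characteristic polynomial. *)
  rewrite [LHS](@all_roots_prod_XsubC _ p rs).
  - by rewrite (monicP (char_poly_monic _)) scale1r.
  - by rewrite size_char_poly size_map size_iota subn1.
  - apply/allP => _ /mapP[j /range/WP[rw re_w _] ->].
    by rewrite -eigenvalue_root_char; apply: wave_eigenvalueP.
  - rewrite uniq_rootsE map_inj_in_uniq ?iota_uniq// => i j /range ir /range jr.
    have [ri pi1 bi] := WP i ir; have [rj pj bj] := WP j jr.
    move/(wave_eigenvalue_inj c_gt0 L_gt0 pi1 pj) => Wij; rewrite Wij in bi.
    apply: (@branch_index_inj N); rewrite ?inE//.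
    have [_ ei] := bi; have [_ ej] := bj.
    have : 2 * pi * (branch N (branch_index N i))%:~R =
        2 * pi * (branch N (branch_index N j))%:~R :> R by lra.
    have pi2 : 2 * pi != 0 :> R by rewrite gt_eqF// mulr_gt0// pi_gt0.
    by move=> /(mulfI pi2)/intr_inj/addIr[].
move=> j jr; have [rw re_w bw] := WP j jr; set w := W j in rw re_w bw *.
rewrite (wave_eigenvalue_polar N c L re_w) /=.
have [e1 e2] := modulus_estimate a01 m_large rw L_gt0.
have e3 := sin_phase_dist jr bw.
rewrite -/h -/d in e1 e2 *.
set r := ComplexField.Normc.normc w in e1 e2 *; set phi := right_arg w in e3 *.
set s := sin (_ / _) in e3 *.
(* Uses [pi < 4] and [4 (N + 1) <= 4 N + 6]. *)
have {}e3 : `| `|sin phi| - `|s| | <= 3 * h / L.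
  apply: le_trans e3 _; rewrite /h /mesh.
  have : 4 * N.+1%:R <= (4 * N + 6)%:R :> R by rewrite -natrM ler_nat; clear; lia.
  have : 0 < N.+1%:R :> R by rewrite ltr0n.
  move: (N.+1%:R : R) ((4 * N + 6)%:R : R) => p q p0 pq.
  have -> : 3 * (L / p) / L = 3 / p by field; rewrite !gt_eqF.
  rewrite ler_pdivrMr; last by lra.
  rewrite mulrAC ler_pdivlMr//.
  have := ler_wpM2r (ltW p0) (ltW (pihalf_lt2 R)); lra.
clearbody h.
have r0 : 0 < r by have [] := spectral_root_admissible a01 m_large rw.
have S0 : 0 <= r + r^-1 by rewrite addr_ge0 ?invr_ge0 ?(ltW r0).
have scale (x : R) : h * `|c / h * x| = c * `|x|.
  by rewrite normrM (gtr0_norm (divr_gt0 c_gt0 h0)) mulrA mulrCA divff ?mulr1// gt_eqF.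
have K1E : K1 * h = c * (h / (2 * d * L) + 2 * (3 * h / L)).
  by rewrite /K1; field; rewrite !gt_eqF.
have e0 : 0 <= h / (2 * d * L) by apply: ltW; rewrite divr_gt0 ?mulr_gt0.
have f0 : 0 <= 3 * h / L by apply: ltW; rewrite divr_gt0 ?mulr_gt0.
set X := c / h * (_ * _); set Y := c / h * (_ * _).
have hX : h * `|X| <= K1 * h.
  rewrite scale K1E ler_pM2l// normrM.
  apply: le_trans (ler_piMr (normr_ge0 _) (cos_max _)) _; lra.
have hY : `|h * `|Y| - 2 * c * `|s| | <= K1 * h.
  rewrite scale K1E normrM (ger0_norm S0).
  have -> : c * ((r + r^-1) * `|sin phi|) - 2 * c * `|s| =
      c * ((r + r^-1 - 2) * `|sin phi| + 2 * (`|sin phi| - `|s|)) by ring.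
  rewrite normrM gtr0_norm// ler_pM2l// (le_trans (ler_normD _ _))// !normrM.
  rewrite normr_id (ger0_norm (ler0n R 2)) lerD ?ler_pM2l//.
  exact: le_trans (ler_piMr (normr_ge0 _) (sin_max _)) _.
have K1K : K1 * h <= (K1 + 4 * c * K1 + 2 * K1 ^+ 2 * L) * h.
  by rewrite ler_pM2r// -addrA lerDl addr_ge0 ?mulr_ge0 ?sqr_ge0 ?(ltW c_gt0) ?(ltW L_gt0).
split; [exact: le_trans K1K | exact: le_trans K1K |].
rewrite sqr_sqrtr ?addr_ge0 ?sqr_ge0// -[X ^+ 2]real_normK ?num_real//.
rewrite -[Y ^+ 2]real_normK ?num_real// -[s ^+ 2]real_normK ?num_real// mulrDr -!exprMn.
have s1 : `|s| <= 1 := sin_max _.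
have hX0 : 0 <= h * `|X| by rewrite mulr_ge0 ?(ltW h0).
have hY0 : 0 <= h * `|Y| by rewrite mulr_ge0 ?(ltW h0).
have hY1 : h * `|Y| <= 2 * c * `|s| + K1 * h by move: hY; rewrite ler_distl => /andP[].
have k0 : 0 <= K1 * h by rewrite mulr_ge0 ?(ltW h0).
have sqX : (h * `|X|) ^+ 2 <= (K1 * h) ^+ 2 by rewrite lerXn2r.
have sqY : (h * `|Y|) ^+ 2 <= (2 * c * `|s| + K1 * h) ^+ 2.
  by rewrite lerXn2r ?nnegrE// (le_trans hY0).
have cross : c * (K1 * h) * `|s| <= c * (K1 * h).
  by rewrite ler_piMr// mulr_ge0 ?(ltW c_gt0).
have quad : (K1 * h) ^+ 2 <= K1 ^+ 2 * L * h.
  by rewrite exprMn [h ^+ 2]expr2 mulrA ler_pM2r// ler_wpM2l ?sqr_ge0.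
have sqE : (2 * c * `|s| + K1 * h) ^+ 2 =
  4 * c ^+ 2 * `|s| ^+ 2 + 4 * (c * (K1 * h) * `|s|) + (K1 * h) ^+ 2 by ring.
lra.
Qed.
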